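(* There are exactly $2$ pairwise non-isomorphic $(K_4-e)$-designs of order $11$.
   Context: $K_4-e$ is the graph on four vertices $a,b,c,d$ with edges $ab,ac,ad,bc,bd$; it is denoted $[a,b,c-d]$. A $(K_4-e)$-design of order $v$ is a pair $(X,\mathcal B)$ where $X$ is a set of $v$ vertices and $\mathcal B$ is a collection of copies of $K_4-e$ (called blocks) with vertices in $X$ whose edge sets partition the edge set of the complete graph $K_v$ on $X$. Two $(K_4-e)$-designs $(X,\mathcal B_1)$ and $(X,\mathcal B_2)$ are isomorphic if there is a permutation $\pi$ of $X$ with $\pi(\mathcal B_1)=\mathcal B_2$, where $\pi$ is applied to the vertices of each block. *)

(* Defs.v *)
From mathcomp Require Import all_boot fingroup perm.
Set Implicit Arguments. Unset Strict Implicit. Unset Printing Implicit Defensive.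

Definition edges_Kv (v : nat) : {set {set 'I_v}} :=
  [set e : {set 'I_v} | #|e| == 2].

(* A block is a copy of K_4 - e, identified with its edge set:
   [a,b,c-d] has edges ab, ac, ad, bc, bd with a,b,c,d distinct. *)
Definition is_K4e (v : nat) (B : {set {set 'I_v}}) : Prop :=
  exists a b c d : 'I_v,
    uniq [:: a; b; c; d] /\
    B = [set [set a; b]; [set a; c]; [set a; d]; [set b; c]; [set b; d]].

Definition K4e_design (v : nat) (D : {set {set {set 'I_v}}}) : Prop :=
  (forall B, B \in D -> is_K4e B) /\ partition D (edges_Kv v).

Definition relabel_block (v : nat) (pi : {perm 'I_v}) (B : {set {set 'I_v}})
  : {set {set 'I_v}} := [set (pi @: (e : {set 'I_v}) : {set 'I_v}) | e in B].

Definition iso_designs (v : nat) (D1 D2 : {set {set {set 'I_v}}}) : Prop :=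
  exists pi : {perm 'I_v}, [set relabel_block pi B | B in D1] = D2.

(* Main.v *)
(* In the block [a,b,c-d] the hubs a, b have degree 3 and the tips c, d degree 2.
   If x is a hub of h blocks and a tip of t blocks then 3h + 2t = 10, so h is 0 or
   2; counting incidences gives 11 blocks, and 22 hub incidences over 11 vertices
   force h = 2 everywhere. The hub edges ab thus form a 2-regular graph on 11
   vertices, a disjoint union of cycles of one of six types. For each type, an
   exact cover search over the possible tips has no solution except for the
   11-cycle, where there are four: up to the reflection i |-> 10 - i, the
   developments modulo 11 of the blocks [0,1,3-5] and [0,1,3-7]. Only in the
   first do the two tips of some block have a common neighbour in the hub graph. *)

Require Import Defs.
From mathcomp Require Import all_boot fingroup perm zify.
Set Implicit Arguments. Unset Strict Implicit. Unset Printing Implicit Defensive.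

(** * Cycle decomposition of 2-regular graphs *)

Lemma set2_eq (T : finType) (x y a b : T) :
  ([set x; y] == [set a; b]) = (x == a) && (y == b) || (x == b) && (y == a).
Proof.
apply/eqP/idP => [E|/orP[]/andP[/eqP-> /eqP->] //]; last by rewrite setUC.
have := set21 x y; have := set22 x y; rewrite E !inE.
have := set21 a b; have := set22 a b; rewrite -E !inE ![_ == x]eq_sym ![_ == y]eq_sym.
by do 4 case: eqVneq => //= ?; subst; rewrite ?eqxx //=.
Qed.

Lemma sum_pred1 (I : finType) (P a : pred I) (i : I) :
  P i -> a i -> (forall j, P j -> a j -> j = i) -> \sum_(j | P j) (a j : nat) = 1.
Proof.
move=> Pi ai u; rewrite (bigD1 i) //= ai big1 // => j /andP[Pj ji].
by case aj: (a j) => //; rewrite (u j) ?eqxx in ji.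
Qed.

Section TwoRegular.
Variables (T : finType) (r : rel T).
Hypotheses (r_sym : symmetric r) (r_irr : irreflexive r).
Hypothesis r_reg : forall x, #|[set y | r x y]| = 2.

Lemma nbrs3 x y z t : r x y -> r x z -> r x t -> y != z -> z != t -> y != t -> False.
Proof.
move=> xy xz xt yz zt yt.
have: #|[set y; z; t]| <= #|[set y | r x y]|.
  by apply/subset_leq_card/subsetP => u; rewrite !inE => /orP[/orP[]|]/eqP->.
by rewrite r_reg -setUA cardsU1 cards2 !inE negb_or yz yt zt.
Qed.

Lemma other_nbr x y : r x y -> exists2 z, r x z & z != y.
Proof.
move=> xy; have /eqP := r_reg x; rewrite (cardsD1 y) inE xy.
rewrite eqSS => /cards1P[z /setP/(_ z)]; rewrite !inE eqxx => /andP[zy xz].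
by exists z.
Qed.

(* The end of a longest path from x has both neighbours on the path, and a
   neighbour that is interior to the path would have degree 3. *)
Lemma cycle_from x : exists p : seq T, [/\ path.cycle r (x :: p), uniq (x :: p) & 1 < size p].
Proof.
pose P n := [exists p : n.-tuple T, path r x p && uniq (x :: p)].
have P0 : exists n, P n by exists 0; apply/existsP; exists [tuple].
have Pb n : P n -> n <= #|T|.
  case/existsP=> p /andP[_ /card_uniqP sp].
  by have := max_card (mem (x :: p)); rewrite sp /= size_tuple => /ltnW.
case: (ex_maxnP P0 Pb) => n /existsP[[p /= /eqP <-]] /andP[xp up] pmax.
have stuck y : r (last x p) y -> y \in x :: p.
  move=> py; apply/negPn/negP => yp; suff /pmax : P (size p).+1 by rewrite ltnn.
  have sz : size (rcons p y) == (size p).+1 by rewrite size_rcons.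
  have uz : uniq (x :: rcons p y) by rewrite -rcons_cons rcons_uniq yp.
  by apply/existsP; exists (Tuple sz); rewrite uz /= rcons_path xp py.
case/lastP: p xp up stuck {pmax} => [_ _ stuck|p y].
  have /card_gt0P[y] : 0 < #|[set y | r x y]| by rewrite r_reg.
  by rewrite inE => xy; have := stuck y xy; rewrite inE => /eqP yx; rewrite yx r_irr in xy.
rewrite rcons_path last_rcons => /andP[xp py] up stuck.
have yp : r y (last x p) by rewrite r_sym.
have [w yw wp] := other_nbr yp.
have := stuck w yw; rewrite -rcons_cons mem_rcons inE => /orP[/eqP wy|].
  by rewrite wy r_irr in yw.
rewrite inE => /orP[/eqP wx|wip].
  exists (rcons p y); split=> //; first by rewrite /= !rcons_path last_rcons xp py -wx.
  (* If [p] were empty, [w = x] would be the predecessor of [y] on the path, which [wp] excludes;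
     hence the cycle has at least three vertices. *)
  by rewrite size_rcons; case: p wp {xp py up stuck yp} => //=; rewrite wx eqxx.
exfalso; case/splitPr: wip wp xp py up {stuck yp} => p1 [|u p2] wp.
  by rewrite last_cat /= eqxx in wp.
rewrite cat_path /= => /and4P[_ r1 wu _] _.
rewrite -[_ && _]/(uniq (x :: _)) -rcons_cons -cat_cons rcons_cat cat_uniq.
case/and3P=> _ /hasPn dis /andP[_ up2].
have uy : u != y.
  have : uniq (rcons (u :: p2) y) by [].
  by rewrite rcons_uniq inE negb_or eq_sym => /andP[/andP[]].
have := dis u; have := dis y; rewrite !inE !mem_rcons !inE !eqxx !orbT => /(_ isT) yp1 /(_ isT) up1.
have lp1 : last x p1 \in x :: p1 by apply: mem_last.
apply: (@nbrs3 w (last x p1) u y) => //; rewrite 1?r_sym //.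
  by apply: contra up1 => /eqP <-; rewrite -in_cons.
by apply: contra yp1 => /eqP <-; rewrite -in_cons.
Qed.

(** On a cycle of length at least 3 the successor and the predecessor of [x] are two distinct
    neighbours, and degree 2 leaves no third. *)
Lemma cycle_nbrs c x y : path.cycle r c -> uniq c -> 2 < size c -> x \in c -> r x y ->
  y = next c x \/ x = next c y.
Proof.
move=> rc uc sc xc xy.
have rn : r x (next c x) := next_cycle rc xc.
have rp : r x (prev c x) by rewrite r_sym; exact: prev_cycle rc xc.
case: (eqVneq y (next c x)) => [->|yn]; first by left.
case: (eqVneq y (prev c x)) => [->|yp]; first by right; rewrite next_prev.
case: (nbrs3 xy rn rp) => //; apply/eqP => E.
have : next c (next c x) = x by rewrite E next_prev.
(* Rotating [c] to begin at [x] makes [next c (next c x)] its third entry, or again the first only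
   if [c] is too short. *)
have [i d def_c] := rot_to xc.
have next_c z : next c z = next (rot i c) z by rewrite next_rot.
move: uc sc; rewrite !next_c -(rot_uniq i) -(size_rot i c) def_c => uc sc.
case: d uc sc {def_c next_c} => [|a [|b d]] //=; rewrite !inE !negb_or eqxx.
case/andP=> /and3P[/negPf xa /negPf xb _] _ _.
by rewrite eqxx eq_sym xa => bx; rewrite bx eqxx in xb.
Qed.

Lemma cycle_decomposition : exists cs : seq (seq T),
  perm_eq (flatten cs) (enum T) /\
  (forall c, c \in cs -> [/\ path.cycle r c, uniq c & 2 < size c]).
Proof.
suff [cs [ucs mcs Hcs]] : exists cs : seq (seq T),
    [/\ uniq (flatten cs), flatten cs =i [set: T] &
        forall c, c \in cs -> [/\ path.cycle r c, uniq c & 2 < size c]].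
  exists cs; split=> //; apply: uniq_perm; rewrite ?enum_uniq // => x.
  by rewrite mcs inE mem_enum.
(* Induction on the size of a vertex set [A] closed under adjacency: removing a cycle leaves a
   closed set, because by [cycle_nbrs] no edge leaves the cycle. *)
have : forall x y, x \in [set: T] -> r x y -> y \in [set: T] by move=> ? ?; rewrite !inE.
have [n] := ubnP #|[set: T]|; elim: n [set: T] => // n IH A ltA clA.
case: (set_0Vmem A) => [->|[x xA]].
  by exists [::]; split=> // x; rewrite inE.
have [p [rp up sp]] := cycle_from x; set c := x :: p in rp up.
have cA : {subset c <= A}.
  have : path r x p by move: rp; rewrite /= rcons_path => /andP[].
  move=> pp y; rewrite inE => /orP[/eqP->//|].
  elim: (p) (x) xA pp => //= z q IHq u uA /andP[uz qz]; have zA := clA _ _ uA uz.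
  by rewrite inE => /orP[/eqP->//|]; apply: (IHq z).
have clc u v : r u v -> v \in c -> u \in c.
  move=> uv vc; rewrite r_sym in uv.
  have [->|vn] := cycle_nbrs rp up sp vc uv; first by rewrite mem_next.
  by rewrite vn mem_next in vc.
have [||cs [ucs mcs Hcs]] := IH (A :\: [set y in c]).
- apply: leq_trans (ltA : #|A| <= n); apply: proper_card; apply/properP; split; first exact: subsetDl.
  by exists x; rewrite // !inE eqxx.
- move=> u v; rewrite !inE -!in_cons => /andP[uc uA] uv; rewrite (clA u) // andbT.
  by apply: contra uc; apply: clc.
exists (c :: cs); split.
- rewrite -[flatten _]/(c ++ flatten cs) cat_uniq up ucs andbT; apply/hasPn => y; rewrite mcs !inE => /andP[].
  by rewrite -in_cons.
- move=> y; rewrite -[flatten _]/(c ++ flatten cs) mem_cat mcs in_setD [y \in finset _]inE.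
  by case: (boolP (y \in c)) => // /cA ->.
- by move=> d; rewrite inE => /orP[/eqP->|/Hcs].
Qed.

End TwoRegular.

(** * Degrees in designs *)

Section Blocks.
Variable v : nat.
Implicit Types (a b c d x y : 'I_v) (B : {set {set 'I_v}}) (D : {set {set {set 'I_v}}}).

Definition K4e a b c d : {set {set 'I_v}} :=
  [set [set a; b]; [set a; c]; [set a; d]; [set b; c]; [set b; d]].

(** A block is only a set of edges, so its hubs and tips are recovered from the vertex degrees
    inside it. *)
Definition nbrs B x := [set y | (x != y) && ([set x; y] \in B)].
Definition hub B := [set x | #|nbrs B x| == 3].
Definition tips B := [set x | #|nbrs B x| == 2].

Lemma K4e_swap_hub a b c d : K4e b a c d = K4e a b c d.
Proof.
apply/setP => e; rewrite !inE [[set b; a]]setUC.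
by do 5 case: (e == _).
Qed.

Lemma K4e_swap_tips a b c d : K4e a b d c = K4e a b c d.
Proof. by apply/setP => e; rewrite !inE; do 5 case: (e == _). Qed.

(** The conditionals have the shape of the search test [inc], so that [incE] can rest on this
    lemma. *)
Lemma mem_K4e a b c d x y : uniq [:: a; b; c; d] -> x != y ->
  ([set x; y] \in K4e a b c d) =
    if x == a then [|| y == b, y == c | y == d]
    else if x == b then [|| y == a, y == c | y == d]
    else if (y == a) || (y == b) then (x == c) || (x == d) else false.
Proof.
rewrite /= !inE !negb_or !set2_eq => /and4P[/and3P[ab ac ad] /andP[bc bd] cd _] xy.
have [xa|xa] := eqVneq x a.
  subst x; rewrite (negPf ab) (negPf ac) (negPf ad) /= ?orbF.
  by rewrite ?(andbF, orbF) -!orbA.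
have [xb|xb] := eqVneq x b.
  subst x; rewrite (negPf bc) (negPf bd) /= ?(andbF, orbF) ?orFb.
  by rewrite -!orbA.
by case: (y == a); case: (y == b); case: (x == c); case: (x == d).
Qed.

Lemma nbrs_K4e a b c d x : uniq [:: a; b; c; d] ->
  nbrs (K4e a b c d) x =
    if x == a then [set b; c; d] else if x == b then [set a; c; d]
    else if (x == c) || (x == d) then [set a; b] else set0.
Proof.
move=> u; apply/setP => y; rewrite [LHS]inE.
have [<-|xy] /= := eqVneq x y; last first.
  rewrite mem_K4e //; case: (x == a); first by rewrite !inE -!orbA.
  case: (x == b); first by rewrite !inE -!orbA.
  by case: ((x == c) || (x == d)); rewrite ?inE; case: ifP.
move: u; rewrite /= !inE !negb_or => /and4P[/and3P[ab ac ad] /andP[bc bd] cd _].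
have [xa|xa] := eqVneq x a; first by subst x; rewrite !inE (negPf ab) (negPf ac) (negPf ad).
have [xb|xb] := eqVneq x b.
  by subst x; rewrite !inE eq_sym (negPf ab) (negPf bc) (negPf bd).
by case: ifP; rewrite !inE ?(negPf xa) ?(negPf xb).
Qed.

Lemma card_nbrs_K4e a b c d x : uniq [:: a; b; c; d] ->
  #|nbrs (K4e a b c d) x| =
    if x \in [set a; b] then 3 else if x \in [set c; d] then 2 else 0.
Proof.
move=> u; rewrite nbrs_K4e // !inE.
move: u; rewrite /= !inE !negb_or => /and4P[/and3P[ab ac ad] /andP[bc bd] cd _].
have [xa|xa] := eqVneq x a; first by rewrite -setUA cardsU1 cards2 !inE negb_or bc bd cd.
have [xb|xb] := eqVneq x b; first by rewrite -setUA cardsU1 cards2 !inE negb_or ac ad cd.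
by case: ((x == c) || (x == d)); rewrite ?cards2 ?ab ?cards0.
Qed.

Lemma hub_K4e a b c d : uniq [:: a; b; c; d] -> hub (K4e a b c d) = [set a; b].
Proof.
move=> u; apply/setP => x; rewrite [LHS]inE card_nbrs_K4e //.
by case: (x \in [set a; b]); case: (x \in [set c; d]).
Qed.

Lemma tips_K4e a b c d : uniq [:: a; b; c; d] -> tips (K4e a b c d) = [set c; d].
Proof.
move=> u; apply/setP => x; rewrite [LHS]inE card_nbrs_K4e //.
case: (boolP (x \in [set a; b])) => [|_]; last by case: (x \in [set c; d]).
move: u; rewrite /= !inE !negb_or => /and4P[/and3P[ab ac ad] /andP[bc bd] cd _].
by case/orP=> /eqP->; apply/esym/negbTE; rewrite negb_or ?ac ?ad ?bc ?bd.
Qed.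

(** Replaces the partition by the two facts used later: existence and uniqueness of the block
    through a pair of vertices. *)
Lemma designP D : K4e_design D <->
  [/\ forall B, B \in D -> is_K4e B,
      forall x y, x != y -> exists2 B, B \in D & [set x; y] \in B &
      forall x y B B', x != y -> B \in D -> B' \in D ->
        [set x; y] \in B -> [set x; y] \in B' -> B = B'].
Proof.
have K2 B e : is_K4e B -> e \in B -> exists x y, x != y /\ e = [set x; y].
  case=> a [b [c [d [+ ->]]]].
  rewrite /= !inE !negb_or => /and4P[/and3P[ab ac ad] /andP[bc bd] _ _].
  case/orP=> [/orP[/orP[/orP[]|]|]|] /eqP->;
    [exists a, b | exists a, c | exists a, d | exists b, c | exists b, d] => //.
split=> [[DK /and3P[/eqP Dcov /trivIsetP Dtriv _]]|[DK Dcov Duniq]].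
  split=> // [x y xy | x y B B' _ BD B'D eB eB'].
    have /bigcupP[B BD eB] : [set x; y] \in cover D by rewrite Dcov inE cards2 xy.
    by exists B.
  apply/eqP/negPn/negP => /(Dtriv _ _ BD B'D)/disjoint_setI0/setP/(_ [set x; y]).
  by rewrite in_setI eB eB' inE.
split=> //; apply/and3P; split.
- rewrite eqEsubset; apply/andP; split; apply/subsetP => e.
    by case/bigcupP=> B /DK KB /(K2 _ _ KB)[x [y [xy ->]]]; rewrite inE cards2 xy.
  move=> eE; have /cards2P[x [y [xy ->]]] : #|e| == 2 by rewrite inE in eE.
  by have [B BD eB] := Dcov x y xy; apply/bigcupP; exists B.
- apply/trivIsetP => B B' BD B'D; apply: contraR => /pred0Pn[e /andP[/= eB eB']].
  have [x [y [xy e_xy]]] := K2 B e (DK _ BD) eB.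
  by rewrite e_xy in eB eB'; rewrite (Duniq _ _ _ _ xy BD B'D eB eB').
- apply/negP => /DK[a [b [c [d [_ /setP/(_ [set a; b])]]]]].
  by rewrite !inE eqxx.
Qed.

Definition hub_rel D x y := [exists B in D, hub B == [set x; y]].

Lemma hub_relP D x y :
  reflect (exists2 B, B \in D & hub B = [set x; y]) (hub_rel D x y).
Proof.
by apply: (iffP exists_inP) => -[B BD /eqP hB]; exists B; rewrite // hB.
Qed.

Variable D : {set {set {set 'I_v}}}.
Hypothesis designD : K4e_design D.

(** Double counting of the pairs of a block and an edge at [x] in it: each other vertex is joined to
    [x] in exactly one block. *)
Lemma sum_nbrs x : \sum_(B in D) #|nbrs B x| = v.-1.
Proof.
have [DK Dcov Duniq] := (designP D).1 designD.
have -> : v.-1 = \sum_(y | x != y) 1.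
  by rewrite sum1_card -[v in LHS]card_ord -(cardC1 x); apply: eq_card => y; rewrite !inE eq_sym.
transitivity (\sum_(B in D) \sum_(y | x != y) ([set x; y] \in B : nat)).
  apply: eq_bigr => B _; rewrite -sum1_card big_mkcond [RHS]big_mkcond.
  by apply: eq_bigr => y _; rewrite inE; case: (x != y) => //=; case: (_ \in B).
rewrite exchange_big; apply: eq_bigr => y xy /=.
have [B BD eB] := Dcov x y xy.
by apply: (sum_pred1 BD eB) => B' B'D eB'; apply: (Duniq x y).
Qed.

Lemma hub_edge B x y : B \in D -> hub B = [set x; y] -> x != y /\ [set x; y] \in B.
Proof.
have [DK _ _] := (designP D).1 designD.
case/DK=> a [b [c [d [u ->]]]]; rewrite hub_K4e // => E; rewrite -E !inE eqxx; split=> //.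
have : #|[set x; y]| = 2 by rewrite -E cards2; move: u; rewrite /= !inE !negb_or => /andP[/andP[->]].
by rewrite cards2; case: (x != y).
Qed.

Lemma hub_rel_sym : symmetric (hub_rel D).
Proof. by move=> x y; rewrite /hub_rel setUC. Qed.

Lemma hub_rel_irr : irreflexive (hub_rel D).
Proof.
move=> x; apply/negbTE/negP => /hub_relP[B BD hB].
by have [/eqP] := hub_edge BD hB.
Qed.

(** Only one block contains a given pair, so an edge of the hub graph is never a hub-tip edge. This
    is what allows [candidates] to discard quadruples. *)
Lemma hub_rel_unique x y B : hub_rel D x y -> B \in D -> [set x; y] \in B -> hub B = [set x; y].
Proof.
have [_ _ Duniq] := (designP D).1 designD.
case/hub_relP=> B' B'D hB' BD eB.
have [xy eB'] := hub_edge B'D hB'.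
by rewrite (Duniq x y B B').
Qed.

(** Both sides count the pairs ([y], [B]) where [x] and [y] are the hubs of [B]: each factor
    determines the other. *)
Lemma card_hub_rel x : #|[set y | hub_rel D x y]| = \sum_(B in D) (x \in hub B).
Proof.
have [DK Dcov Duniq] := (designP D).1 designD.
transitivity (\sum_y \sum_(B in D) (hub B == [set x; y])); last first.
  rewrite exchange_big; apply: eq_bigr => B BD /=.
  have [a [b [c [d [u ->]]]]] := DK B BD; rewrite hub_K4e // in_set2.
  move: u; rewrite /= !inE !negb_or => /andP[/andP[ab _] _].
  have [xa|xa] := eqVneq x a.
    subst x; rewrite (bigD1 b) //= eqxx big1 // => y yb.
    by rewrite set2_eq eqxx [b == y]eq_sym (negPf yb) [b == a]eq_sym (negPf ab) !andbF.
  have [xb|xb] := eqVneq x b.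
    subst x; rewrite (bigD1 a) //= setUC eqxx big1 // => y ya.
    by rewrite set2_eq [a == y]eq_sym (negPf ya) (negPf ab) !andbF.
  by rewrite big1 // => y _; rewrite set2_eq ![_ == x]eq_sym (negPf xa) (negPf xb) !andbF.
rewrite -sum1_card big_mkcond; apply: eq_bigr => y _; rewrite inE.
case: ifPn => [/hub_relP[B BD /eqP hB]|nxy].
  rewrite (sum_pred1 BD hB) // => B' B'D hB'.
  have [xy eB] := hub_edge BD (eqP hB); have [_ eB'] := hub_edge B'D (eqP hB').
  exact: Duniq xy _ _ eB' eB.
rewrite big1 // => B BD; apply/eqP; rewrite eqb0; apply: contra nxy => hB.
by apply/hub_relP; exists B; rewrite ?(eqP hB).
Qed.

End Blocks.

(** * Hub degrees at order 11 *)

Section Order11.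
Variable D : {set {set {set 'I_11}}}.
Hypothesis designD : K4e_design D.

Lemma sum_hub_tips x :
  3 * (\sum_(B in D) (x \in hub B)) + 2 * (\sum_(B in D) (x \in tips B)) = 10.
Proof.
have [DK _ _] := (designP D).1 designD.
rewrite -[RHS](sum_nbrs designD x) !big_distrr -big_split; apply: eq_bigr => B /DK.
case=> a [b [c [d [u ->]]]]; rewrite hub_K4e // tips_K4e // card_nbrs_K4e //=.
move: u; rewrite /= !inE !negb_or => /and4P[/and3P[ab ac ad] /andP[bc bd] cd _].
have [->|xa] := eqVneq x a; first by rewrite (negPf ac) (negPf ad).
have [->|xb] := eqVneq x b; first by rewrite (negPf bc) (negPf bd).
by case: ((x == c) || _).
Qed.

Lemma card_design : #|D| = 11.
Proof.
have [DK _ _] := (designP D).1 designD.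
(* On the left, each block contributes the degree sum 3 * 2 + 2 * 2 = 10; on the right, each of the
   11 vertices has degree 10. *)
suff : 10 * #|D| = 10 * 11 by lia.
transitivity (\sum_(x : 'I_11) 10); last by rewrite sum_nat_const card_ord mulnC.
under eq_bigr => x _ do rewrite -(sum_hub_tips x) !big_distrr -big_split /=.
rewrite exchange_big mulnC -sum_nat_const; apply: eq_bigr => B /DK.
case=> a [b [c [d [u ->]]]]; rewrite hub_K4e // tips_K4e // big_split -!big_distrr /=.
have card_sum (A : {set 'I_11}) : \sum_i (i \in A : nat) = #|A|.
  by rewrite -sum1_card [RHS]big_mkcond; apply: eq_bigr => i _; case: (i \in A).
rewrite !card_sum !cards2.
by move: u; rewrite /= !inE !negb_or => /and4P[/andP[-> _] _ -> _].
Qed.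

Lemma card_hub_rel11 x : #|[set y | hub_rel D x y]| = 2.
Proof.
have [DK _ _] := (designP D).1 designD.
rewrite card_hub_rel //; set h := fun x => \sum_(B in D) (x \in hub B).
(* 3h <= 10 gives h <= 3, and h = 3 fails by parity. *)
have h2 y : h y <= 2 by have := sum_hub_tips y; rewrite -/(h y); lia.
have sum_h : \sum_y h y = 22.
  have -> : 22 = \sum_(B in D) 2 by rewrite sum_nat_const card_design.
  rewrite exchange_big; apply: eq_bigr => B /DK.
  case=> a [b [c [d [u ->]]]]; rewrite hub_K4e //.
  transitivity #|[set a; b]|.
    by rewrite -sum1_card [RHS]big_mkcond; apply: eq_bigr => i _; case: (i \in _).
  by rewrite cards2; move: u; rewrite /= !inE !negb_or => /andP[/andP[->]].
(* The bound [h2] makes the truncated subtraction exact; the deficits add up to 22 - 22, so each of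
   them vanishes. *)
have : \sum_y (2 - h y) == 0.
  by rewrite sumnB // sum_h sum_nat_const card_ord.
rewrite sum_nat_eq0 => /forallP/(_ x); rewrite -/(h x); have := h2 x; lia.
Qed.

End Order11.

(** * Exact cover search *)

Definition edge := (nat * nat)%type.
Definition quad := (nat * nat * nat * nat)%type.

(** The hub edge comes first, so [behead] leaves the four hub-tip edges. *)
Definition quad_edges (q : quad) : seq edge :=
  let: (a, b, c, d) := q in [:: (a, b); (a, c); (a, d); (b, c); (b, d)].

(* The conditionals keep evaluation short; boolean connectives are strict under
   vm_compute. *)
Definition inc (e : edge) (q : quad) : bool :=
  let: (u, v) := e in let: (a, b, c, d) := q in
  if u == a then [|| v == b, v == c | v == d]
  else if u == b then [|| v == a, v == c | v == d]
  else if (v == a) || (v == b) then (u == c) || (u == d) else false.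

Definition meet (q q' : quad) : bool := has (inc^~ q') (quad_edges q).

(** Branching rule of the exact cover search: branch on an edge with fewest live quadruples, and
    give up at once if some edge has none. *)
Fixpoint shortest (live best : seq quad) (es : seq edge) : seq quad :=
  if es is e :: es' then
    let l := [seq q <- live | inc e q] in
    if l is [::] then [::]
    else shortest live (if size l < size best then l else best) es'
  else best.

(* When the fuel n runs out, the partial cover is returned, so completeness
   needs no bound on n. *)
Fixpoint solve (n : nat) (es : seq edge) (live sol : seq quad) : seq (seq quad) :=
  if (n, es) is (n'.+1, e :: es') then
    flatten [seq solve n' [seq e <- es | ~~ inc e q] [seq x <- live | ~~ meet q x] (q :: sol)
            | q <- shortest live [seq q <- live | inc e q] es']
  else [:: sol].

Definition pairs : seq edge :=
  [seq p : edge <- [seq (x, y) | x <- iota 0 11, y <- iota 0 11] | p.1 < p.2].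

(* The hub graph whose cycles have sizes s and consecutive vertex numbers. *)
Definition cycle_edges (s : seq nat) : seq edge :=
  flatten [seq [seq (x, next c x) | x <- c] | c <- reshape s (iota 0 11)].

(** Hubs follow the orientation of [H] and tips increase, which selects one quadruple among the four
    that describe a block. *)
Definition candidates (H : seq edge) : seq quad :=
  [seq q <- [seq (h.1, h.2, p.1, p.2) | h <- H, p <- pairs]
     | let: (a, b, c, d) := q in uniq [:: a; b; c; d] &&
       all (fun e => (e \notin H) && ((e.2, e.1) \notin H)) (behead (quad_edges q))].

Definition same_block (q q' : quad) : bool :=
  let: (a, b, c, d) := q in let: (a', b', c', d') := q' in
  ((a, b) \in [:: (a', b'); (b', a')]) && ((c, d) \in [:: (c', d'); (d', c')]).

(** Translate by [i] of the base block [0,1,3-k]. For k = 5 and for k = 7 its five edges have the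
    differences 1, 2, 3, 4, 5 up to sign modulo 11, each once, so the translates cover every pair
    once. *)
Definition cyclic_quad (k i : nat) : quad :=
  (i, (i + 1) %% 11, (i + 3) %% 11, (i + k) %% 11).

Definition map_quad (f : nat -> nat) (q : quad) : quad :=
  let: (a, b, c, d) := q in (f a, f b, f c, f d).

Definition cyclic_in (sol : seq quad) (k : nat) (g : nat -> nat) : bool :=
  all (fun i => has (same_block (map_quad g (cyclic_quad k i))) sol) (iota 0 11).

Definition is_cyclic (sol : seq quad) : bool :=
  has (fun k => cyclic_in sol k id || cyclic_in sol k (fun x => 10 - x)) [:: 5; 7].

(** The partitions of 11 into parts of size at least 3. *)
Definition sizes :=
  [:: [:: 11]; [:: 8; 3]; [:: 7; 4]; [:: 6; 5]; [:: 5; 3; 3]; [:: 4; 4; 3]].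

(** A cover has 55 / 5 = 11 blocks, so fuel 12 is never exhausted. *)
Definition solutions s := solve 12 pairs (candidates (cycle_edges s)) [::].

(** The hub edges of a cyclic solution form the cycle 0, 1, ..., 10, and those of a candidate lie in
    the prescribed graph. For the five types other than the 11-cycle the check can thus hold only
    because there is no solution. *)
Lemma solutions_cyclic : all (fun s => all is_cyclic (solutions s)) sizes.
Proof. by vm_compute. Qed.

(** * From designs to covers *)

Definition block (f : nat -> 'I_11) (q : quad) : {set {set 'I_11}} :=
  let: (a, b, c, d) := q in K4e (f a) (f b) (f c) (f d).

Definition wf (q : quad) : bool :=
  let: (a, b, c, d) := q in uniq [:: a; b; c; d] && all (gtn 11) [:: a; b; c; d].

Lemma wf_map (f : nat -> 'I_11) q : {in gtn 11 &, injective f} -> wf q ->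
  let: (a, b, c, d) := q in uniq [:: f a; f b; f c; f d].
Proof.
case: q => [[[a b] c] d] finj /andP[u /allP lt].
have -> : [:: f a; f b; f c; f d] = map f [:: a; b; c; d] by [].
by rewrite map_inj_in_uniq // => x y /lt xl /lt yl; apply: finj.
Qed.

(** The bounds on [u] and [w] are part of the equation because [f] may identify a number above 10
    with a label. *)
Lemma incE (f : nat -> 'I_11) q u w : {in gtn 11 &, injective f} -> wf q ->
  inc (u, w) q = [&& u < 11, w < 11, u != w & [set f u; f w] \in block f q].
Proof.
move=> finj wfq; have := wf_map finj wfq; move: wfq.
case: q => [[[a b] c] d] wfq ufq; have /andP[uabcd /allP lt] := wfq.
have [au bu cu du] : [/\ a < 11, b < 11, c < 11 & d < 11].
  by split; apply: lt; rewrite !inE eqxx ?orbT.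
have [ab ac ad bc bd] : [/\ a != b, a != c, a != d, b != c & b != d].
  by move: uabcd; rewrite /= !inE !negb_or => /and4P[/and3P[-> -> ->] /andP[-> ->]].
rewrite /inc /block; have [ul|ul] := boolP (u < 11); last first.
  have nu x : x < 11 -> (u == x) = false by move=> xl; apply: contraNF ul => /eqP->.
  by rewrite (nu a) // (nu b) // (nu c) // (nu d) // if_same.
have [wl|wl] := boolP (w < 11); last first.
  have nw x : x < 11 -> (w == x) = false by move=> xl; apply: contraNF wl => /eqP->.
  by rewrite !nw //= !if_same.
have [<-|uw] /= := eqVneq u w.
  have [ua|ua] := eqVneq u a; first by rewrite ua (negPf ab) (negPf ac) (negPf ad).
  have [ub|ub] := eqVneq u b; first by rewrite ub (negPf bc) (negPf bd).
  by [].
have fE x y : x < 11 -> y < 11 -> (f x == f y) = (x == y).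
  by move=> xl yl; apply/eqP/eqP => [/finj->|->].
by rewrite mem_K4e ?fE.
Qed.

Lemma quad_edges_inc e q : e \in quad_edges q -> inc e q.
Proof.
case: e q => [u w] [[[a b] c] d]; rewrite !inE !xpair_eqE /inc.
by case/orP=> [|/or4P[]] /andP[/eqP-> /eqP->]; rewrite ?eqxx ?orbT //= if_same.
Qed.

(** * Completeness of the search *)

Section Search.
(** [S] stands for the quadruples describing blocks of a fixed design. Two of them sharing an edge
    need not be equal, since hubs or tips may be swapped; they only cover the same edges. *)
Variable S : quad -> Prop.
Hypothesis S_disjoint : forall q q' e, S q -> S q' -> inc e q -> inc e q' -> inc^~ q =1 inc^~ q'.

(** Whichever edge is selected, some quadruple of [S] passes through it, and no edge triggers the
    empty answer. *)
Lemma shortest_complete live best es :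
  (exists2 q, q \in best & S q) ->
  (forall e, e \in es -> exists q, [/\ q \in live, S q & inc e q]) ->
  exists2 q, q \in shortest live best es & S q.
Proof.
elim: es best => //= e es IH best Sbest cov.
have [q [ql Sq eq]] := cov e (mem_head _ _).
have qin : q \in [seq q <- live | inc e q] by rewrite mem_filter eq.
case def_l: [seq q <- live | inc e q] qin => [//|q' l] qin.
apply: IH => [|e' e'es]; last by apply: cov; rewrite inE e'es orbT.
by case: ifP => // _; exists q.
Qed.

(** Follows the branch that always picks a quadruple of [S]. The invariant is that each uncovered
    edge still lies on a live quadruple of [S]. *)
Lemma solve_complete n es live sol :
  (forall q, q \in sol -> S q) ->
  (forall e, e \in es -> exists q, [/\ q \in live, S q & inc e q]) ->
  exists2 sol', sol' \in solve n es live sol & forall q, q \in sol' -> S q.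
Proof.
elim: n es live sol => [|n IH] [|e es] live sol Ssol cov;
  try by exists sol; rewrite //= inE.
have [||q qin Sq] := @shortest_complete live [seq q <- live | inc e q] es.
- have [q [ql Sq eq]] := cov e (mem_head _ _).
  by exists q; rewrite // mem_filter eq.
- by move=> e' e'es; apply: cov; rewrite inE e'es orbT.
have [||sol' sol'in Ssol'] := IH [seq e <- e :: es | ~~ inc e q]
  [seq x <- live | ~~ meet q x] (q :: sol).
- by move=> x; rewrite inE => /orP[/eqP->|/Ssol].
- move=> e'; rewrite mem_filter => /andP[e'q /cov[q' [q'l Sq' e'q']]].
  exists q'; split=> //; rewrite mem_filter q'l andbT.
  (* If [q'] met [q], both would cover the same edges, and [e'] would already be covered by [q]. *)
  apply: contra e'q => /hasP[e0 /quad_edges_inc e0q e0q'].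
  by rewrite (S_disjoint Sq Sq' e0q e0q').
by exists sol' => //; apply/flattenP; eexists; last exact: sol'in; apply/mapP; exists q.
Qed.
End Search.

(** Four parts of size at least 3 exceed 11, and with three parts the smallest is 3 because 3 * 4
    exceeds 11. *)
Lemma sizes_complete s : all (leq 3) s -> sumn s = 11 -> sorted geq s -> s \in sizes.
Proof.
case: s => [|a [|b [|c [|d s]]]] //=; rewrite ?andbT /geq /=.
- by rewrite addn0 => _ ->.
- move=> ab3 sum_ab ba; have : b \in [:: 3; 4; 5] by rewrite !inE; lia.
  by rewrite !inE => /or3P[] /eqP bE; (have -> : a = 11 - b by lia); rewrite bE.
- move=> abc sum_abc /andP[ba cb].
  have -> : c = 3 by lia.
  have : b \in [:: 3; 4] by rewrite !inE; lia.
  by rewrite !inE => /orP[] /eqP bE; (have -> : a = 8 - b by lia); rewrite bE.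
- by move=> /and5P[]; lia.
Qed.

Section Labelling.
Variable D : {set {set {set 'I_11}}}.
Hypothesis designD : K4e_design D.

Lemma hub_labelling : exists s (f : nat -> 'I_11) (g : 'I_11 -> nat), [/\ s \in sizes,
  cancel g f, (forall x, g x < 11), {in gtn 11, cancel f g} &
  (forall x y, hub_rel D x y -> (g x, g y) \in cycle_edges s \/ (g y, g x) \in cycle_edges s) /\
  (forall u w, (u, w) \in cycle_edges s -> hub_rel D (f u) (f w))].
Proof.
have hs := hub_rel_sym D; have hi := hub_rel_irr designD; have hr := card_hub_rel11 designD.
have [cs0 [pcs0 Hcs0]] := cycle_decomposition hs hi hr.
(* Sorting by decreasing length brings the shape into the list [sizes]; vertices are then numbered
   by their position in the concatenation [L]. *)
pose cs := sort (relpre size geq) cs0; pose L := flatten cs.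
have Hcs c : c \in cs -> [/\ path.cycle (hub_rel D) c, uniq c & 2 < size c].
  by rewrite mem_sort; apply: Hcs0.
have pL : perm_eq L (enum 'I_11).
  by apply: perm_trans pcs0; apply: perm_flatten; rewrite perm_sort.
have uL : uniq L by rewrite (perm_uniq pL) enum_uniq.
have sL : size L = 11 by rewrite (perm_size pL) size_enum_ord.
have mL x : x \in L by rewrite (perm_mem pL) mem_enum.
pose f := nth ord0 L; pose g := index^~ L.
have gf : cancel g f by move=> x; apply: nth_index.
have g_lt x : g x < 11 by rewrite -sL index_mem.
have fg : {in gtn 11, cancel f g} by move=> u /= ul; rewrite /g /f index_uniq ?sL.
have csE : reshape (shape cs) (iota 0 11) = [seq [seq g x | x <- c] | c <- cs].
  rewrite -[cs in RHS]flattenK map_reshape -/L; congr reshape.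
  apply: (@eq_from_nth _ 0); rewrite size_iota ?size_map ?sL // => i il.
  by rewrite nth_iota // (nth_map ord0) ?sL // [g _]index_uniq ?sL.
have edgeP u w : reflect (exists c x, [/\ c \in cs, x \in c, u = g x & w = g (next c x)])
                  ((u, w) \in cycle_edges (shape cs)).
  apply: (iffP flatten_mapP); rewrite csE.
    case=> c' /mapP[c ccs ->] /mapP[x' /mapP[x xc ->] [-> ->]].
    exists c, x; split=> //; rewrite next_map //; first exact: can_inj gf.
    by have [] := Hcs c ccs.
  case=> c [x [ccs xc -> ->]]; exists (map g c); first exact: map_f.
  apply/mapP; exists (g x); rewrite ?map_f // next_map //; first exact: can_inj gf.
  by have [] := Hcs c ccs.
exists (shape cs), f, g; split=> //; last split.
- apply: sizes_complete; last 1 first.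
  + rewrite sorted_map; apply: sort_sorted => c d; exact: leq_total.
  + by apply/allP => n /mapP[c /Hcs[_ _ sc] ->].
  + by rewrite -size_flatten.
- move=> x y xy; have /flattenP[c ccs xc] := mL x.
  have [rc uc sc] := Hcs c ccs.
  have [yE|xE] := cycle_nbrs hs hr rc uc sc xc xy.
    by left; apply/edgeP; exists c, x; rewrite yE.
  right; apply/edgeP; exists c, y; split=> //; last by rewrite xE.
  by rewrite xE mem_next in xc.
- move=> u w /edgeP[c [x [ccs xc -> ->]]]; rewrite !gf.
  by have [rc _ _] := Hcs c ccs; apply: next_cycle.
Qed.

(** The search is run on the labelled hub graph of [D]. Some returned solution consists of blocks of
    [D], and by [solutions_cyclic] it contains a cyclic family. *)
Lemma design_cyclic : exists (k : nat) (f : nat -> 'I_11), [/\ k \in [:: 5; 7],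
  {in gtn 11 &, injective f} & forall i, i < 11 -> block f (cyclic_quad k i) \in D].
Proof.
have [s [f [g [sP gf g_lt fg [hub_H H_hub]]]]] := hub_labelling.
have [DK Dcov Duniq] := (designP D).1 designD.
have finj : {in gtn 11 &, injective f} by apply: can_in_inj fg.
pose S q := wf q /\ block f q \in D.
have S_disj q q' e : S q -> S q' -> inc e q -> inc e q' -> inc^~ q =1 inc^~ q'.
  case: e => u w [wfq qD] [wfq' q'D]; rewrite !(incE _ _ finj) //.
  case/and4P=> ul wl uw eq /and4P[_ _ _ eq'] [u' w'].
  rewrite !(incE _ _ finj) // (Duniq (f u) (f w) (block f q) (block f q')) //.
  by apply: contraNneq uw => /finj->.
have candP B : B \in D -> exists q, [/\ q \in candidates (cycle_edges s), S q & block f q = B].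
  move=> BD; have [a [b [c [d [u BE]]]]] := DK B BD.
  have hB : hub B = [set a; b] by rewrite BE; apply: hub_K4e.
  (* Swapping hubs orients the pair along its cycle; swapping tips then orders them by label, as
     [candidates] demands. *)
  wlog abH : a b u BE hB / (g a, g b) \in cycle_edges s.
    move=> W; have : hub_rel D a b by apply/hub_relP; exists B.
    case/hub_H => [|baH]; first exact: (W a b).
    apply: (W b a) => //; last by rewrite setUC.
      by move: u; rewrite /= !inE !negb_or [b == a]eq_sym; case/and4P=> /and3P[-> -> ->] /andP[-> ->] -> _.
    by rewrite BE; apply: esym; apply: K4e_swap_hub.
  wlog cd : c d u BE / g c < g d.
    move=> W; have [lt|gt|/(can_inj gf) E] := ltngtP (g c) (g d); first exact: (W c d).
      apply: (W d c) => //; last by rewrite BE; apply: esym; apply: K4e_swap_tips.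
      move: u; rewrite /= !inE !negb_or [d == c]eq_sym.
      by case/and4P=> /and3P[-> -> ->] /andP[-> ->] -> _.
    by move: u; rewrite E /= !inE eqxx !andbF.
  have ug : uniq [:: g a; g b; g c; g d].
    have -> : [:: g a; g b; g c; g d] = map g [:: a; b; c; d] by [].
    by rewrite map_inj_uniq //; apply: can_inj gf.
  exists (g a, g b, g c, g d); split.
  - rewrite mem_filter ug; apply/andP; split; last first.
      apply/allpairsP; exists ((g a, g b), (g c, g d)); split=> //.
      rewrite mem_filter; apply/andP; split=> //; apply/allpairsP; exists (g c, g d).
      by rewrite !mem_iota !g_lt.
    have notH x y : [set x; y] \in B -> [set x; y] != [set a; b] ->
        (g x, g y) \notin cycle_edges s /\ (g y, g x) \notin cycle_edges s.
      move=> eB nab; have nxy : ~ hub_rel D x y.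
        by move=> /(hub_rel_unique designD)/(_ BD eB) E; rewrite -E hB eqxx in nab.
      split; apply/negP => /H_hub; rewrite !gf // => H; apply: nxy => //.
      by rewrite hub_rel_sym.
    have eB x y : ((x, y) \in [:: (a, c); (a, d); (b, c); (b, d)]) -> [set x; y] \in B /\ [set x; y] != [set a; b].
      have [ca da cb db] : [/\ c != a, d != a, c != b & d != b].
        move: u; rewrite /= !inE !negb_or ![_ == c]eq_sym ![_ == d]eq_sym.
        by case/and4P=> /and3P[_ -> ->] /andP[-> ->].
      rewrite !inE !xpair_eqE BE !inE => /or4P[] /andP[/eqP-> /eqP->]; rewrite eqxx ?orbT;
        by rewrite set2_eq ?(negPf ca) ?(negPf da) ?(negPf cb) ?(negPf db) !andbF.
    have H x y : ((x, y) \in [:: (a, c); (a, d); (b, c); (b, d)]) ->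
      ((g x, g y) \notin cycle_edges s) && ((g y, g x) \notin cycle_edges s).
      by move=> /eB[e ne]; apply/andP; apply: notH.
    by rewrite /= !H ?inE ?eqxx ?orbT.
  - by split; [rewrite /wf ug /= !g_lt | rewrite /block !gf /K4e -BE].
  - by rewrite BE /= !gf.
have [||sol solin Ssol] := @solve_complete S S_disj 12 pairs (candidates (cycle_edges s)) [::].
- by [].
- case=> u0 w0; rewrite mem_filter => /andP[uw /allpairsP[[u w] [ul wl [uE wE]]]].
  have {uE wE} [uE wE] : u0 = u /\ w0 = w by [].
  move: uw ul wl; rewrite {}uE {}wE !mem_iota add0n => uw /andP[_ ul] /andP[_ wl].
  have fuw : f u != f w by apply: contraTneq uw => /finj->; rewrite ?ltnn.
  have [B BD eB] := Dcov _ _ fuw.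
  have [q [qc Sq qB]] := candP B BD; exists q; split=> //.
  by rewrite (incE _ _ finj) ?ul ?wl ?qB ?eB ?andbT ?neq_ltn ?uw //; case: Sq.
have {solin} : is_cyclic sol by have /allP/(_ s sP)/allP := solutions_cyclic; apply.
have sameP q q' : same_block q q' -> block f q = block f q'.
  case: q q' => [[[a b] c] d] [[[a' b'] c'] d']; rewrite /same_block !inE !xpair_eqE.
  case/andP=> /orP[] /andP[/eqP-> /eqP->] /orP[] /andP[/eqP-> /eqP->]; rewrite /block //.
  - by rewrite K4e_swap_tips.
  - by rewrite K4e_swap_hub.
  - by rewrite K4e_swap_hub K4e_swap_tips.
(* In the reflected case the reflection is absorbed into the labelling; it is injective on the
   labels 0 to 10. *)
case/hasP=> k kP /orP[] /allP H; [exists k, f | exists k, (fun x => f (10 - x))]; split=> //.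
- move=> i il; have /hasP[q /Ssol[_ qD] /sameP] : has (same_block (map_quad id (cyclic_quad k i))) sol.
    by apply: H; rewrite mem_iota.
  by move=> E; rewrite -E in qD.
- move=> x y; rewrite !inE /= => xl yl /finj E.
  by have {E} : 10 - x = 10 - y by [apply: E; rewrite inE /=; lia]; lia.
- move=> i il; have /hasP[q /Ssol[_ qD] /sameP] :
      has (same_block (map_quad (fun x => 10 - x) (cyclic_quad k i))) sol.
    by apply: H; rewrite mem_iota.
  by move=> E; rewrite -E in qD.
Qed.

End Labelling.

(** * The two cyclic designs *)

Lemma relabel_K4e v (pi : {perm 'I_v}) a b c d :
  relabel_block pi (K4e a b c d) = K4e (pi a) (pi b) (pi c) (pi d).
Proof. by rewrite /relabel_block /K4e !imsetU !imset_set1 !imsetU !imset_set1. Qed.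

Lemma relabelK v (pi : {perm 'I_v}) :
  cancel (relabel_block pi) (relabel_block (pi^-1)%g).
Proof.
move=> B; rewrite /relabel_block -imset_comp -[RHS]imset_id; apply: eq_imset => e /=.
by rewrite -imset_comp -[RHS]imset_id; apply: eq_imset => x /=; rewrite permK.
Qed.

Lemma hub_relabel v (pi : {perm 'I_v}) B : is_K4e B ->
  hub (relabel_block pi B) = pi @: hub B /\ tips (relabel_block pi B) = pi @: tips B.
Proof.
case=> a [b [c [d [u ->]]]].
have up : uniq [:: pi a; pi b; pi c; pi d].
  have -> : [:: pi a; pi b; pi c; pi d] = map pi [:: a; b; c; d] by [].
  by rewrite map_inj_uniq //; apply: perm_inj.
by rewrite relabel_K4e !hub_K4e // !tips_K4e // !imsetU !imset_set1.
Qed.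

Definition tips_linked v (D : {set {set {set 'I_v}}}) : Prop :=
  exists B c d m, [/\ B \in D, tips B = [set c; d], hub_rel D c m & hub_rel D m d].

(** Hubs and tips are defined by degrees, so a relabelling carries the hub graph and the tip pairs
    along. *)
Lemma tips_linked_iso v (D D' : {set {set {set 'I_v}}}) :
  K4e_design D -> iso_designs D D' -> tips_linked D -> tips_linked D'.
Proof.
move=> [DK _] [pi <-] [B [c [d [m [BD tB cm md]]]]].
have hub_pi x y : hub_rel D x y ->
    hub_rel [set relabel_block pi B | B in D] (pi x) (pi y).
  case/hub_relP=> B' B'D hB'; apply/hub_relP; exists (relabel_block pi B'); first exact: imset_f.
  by have [-> _] := hub_relabel pi (DK _ B'D); rewrite hB' imsetU !imset_set1.
exists (relabel_block pi B), (pi c), (pi d), (pi m); split; try exact: hub_pi; first exact: imset_f.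
by have [_ ->] := hub_relabel pi (DK _ BD); rewrite tB imsetU !imset_set1.
Qed.

Definition cyclic_design (k : nat) : {set {set {set 'I_11}}} :=
  [set block inord (cyclic_quad k i) | i : 'I_11].

Definition cyclic_quads k := [seq cyclic_quad k i | i <- iota 0 11].

(** Numerical hub graph. Quadruples nest to the left: [q.1.1] is the hub pair, while [q.1.2] and
    [q.2] are the tips. *)
Definition adj k (x y : nat) : bool :=
  has (fun q => ((x, y) == q.1.1) || ((y, x) == q.1.1)) (cyclic_quads k).

Lemma cyclic_quads_ok : all (fun k => all wf (cyclic_quads k) &&
  all (fun e => count (inc e) (cyclic_quads k) == 1) pairs) [:: 5; 7].
Proof. by vm_compute. Qed.

(** The hub graph is the cycle of steps 1 modulo 11, and the tips i + 3 and i + 7 are at distance 4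
    on it. *)
Lemma cyclic_quads7_unlinked : all (fun q =>
  all (fun m => ~~ (adj 7 q.1.2 m && adj 7 m q.2)) (iota 0 11)) (cyclic_quads 7).
Proof. by vm_compute. Qed.

Lemma inord_inj n : {in gtn n.+1 &, injective (@inord n)}.
Proof. by move=> x y xn yn /(congr1 val); rewrite /= !inordK. Qed.

Lemma cyclic_designP k B :
  reflect (exists2 q, q \in cyclic_quads k & B = block inord q) (B \in cyclic_design k).
Proof.
apply: (iffP imsetP) => [[i _ ->]|[q /mapP[i + ->] ->]].
  by exists (cyclic_quad k i); rewrite // map_f // mem_iota ltn_ord.
by rewrite mem_iota => /andP[_ il]; exists (Ordinal il).
Qed.

Section CyclicDesign.
Variable k : nat.
Hypothesis k57 : k \in [:: 5; 7].

Lemma cyclic_wf q : q \in cyclic_quads k -> wf q.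
Proof. by have /allP/(_ k k57)/andP[/allP wfk _] := cyclic_quads_ok; apply: wfk. Qed.

Lemma cyclic_designK : K4e_design (cyclic_design k).
Proof.
have finj := @inord_inj 10.
have incK q x y : q \in cyclic_quads k -> x != y ->
    inc (val x, val y) q = ([set x; y] \in block inord q).
  move=> qk xy; rewrite (incE _ _ finj) ?cyclic_wf // !ltn_ord !inord_val.
  by rewrite (inj_eq val_inj) xy.
have cnt (x y : 'I_11) : x < y -> count (inc (val x, val y)) (cyclic_quads k) = 1.
  move=> xy; have /allP/(_ k k57)/andP[_ /allP ck] := cyclic_quads_ok.
  apply/eqP/ck; rewrite mem_filter; apply/andP; split=> //.
  by apply/allpairsP; exists (val x, val y); rewrite !mem_iota !ltn_ord.
(* The computation only treats increasing pairs; symmetry extends it to all pairs of distinct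
   vertices. *)
have wlogP (P : 'I_11 -> 'I_11 -> Prop) : (forall x y, P x y -> P y x) ->
    (forall x y : 'I_11, x < y -> P x y) -> forall x y, x != y -> P x y.
  move=> sP lP x y; rewrite neq_ltn => /orP[|] /lP //; exact: sP.
apply/designP; split.
- move=> B /cyclic_designP[q qk ->]; have := wf_map finj (cyclic_wf qk).
  by case: q {qk} => [[[a b] c] d] u; exists (inord a), (inord b), (inord c), (inord d).
- apply: wlogP => [x y|x y xy]; first by rewrite setUC.
  have /hasP[q qk] : has (inc (val x, val y)) (cyclic_quads k) by rewrite has_count cnt.
  rewrite incK // ?neq_ltn ?xy // => e; exists (block inord q) => //.
  by apply/cyclic_designP; exists q.
- move=> x y B B' xy BD B'D; move: x y xy; apply: wlogP => [x y|x y xy]; first by rewrite setUC.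
  have [[q qk ->] [q' q'k ->]] := (cyclic_designP _ _ BD, cyclic_designP _ _ B'D).
  rewrite -!incK ?neq_ltn ?xy // => e e'.
  have := cnt x y xy; rewrite -size_filter.
  have : q \in [seq q <- cyclic_quads k | inc (val x, val y) q] by rewrite mem_filter e.
  have : q' \in [seq q <- cyclic_quads k | inc (val x, val y) q] by rewrite mem_filter e'.
  by case: [seq _ <- _ | _] => [|z [|? ?]] //; rewrite !inE => /eqP-> /eqP->.
Qed.

(** The labelling restricts to a permutation of the vertices that sends the cyclic design into [D].
    Both have 11 blocks, so the image is all of [D], and the inverse permutation is the
    isomorphism. *)
Lemma iso_cyclic (D : {set {set {set 'I_11}}}) f : K4e_design D ->
  {in gtn 11 &, injective f} -> (forall i, i < 11 -> block f (cyclic_quad k i) \in D) ->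
  iso_designs D (cyclic_design k).
Proof.
move=> designD finj fD.
have pinj : injective (fun x : 'I_11 => f x) by move=> x y /finj E; apply/val_inj/E; exact: ltn_ord.
pose pi := perm pinj.
have sub : [set relabel_block pi B | B in cyclic_design k] \subset D.
  apply/subsetP => _ /imsetP[_ /cyclic_designP[q qk ->] ->].
  suff -> : relabel_block pi (block inord q) = block f q.
    by case/mapP: qk => i + ->; rewrite mem_iota => /andP[_ /fD].
  move/cyclic_wf: qk; case: q => [[[a b] c] d] /and3P[_ al /and4P[bl cl dl _]].
  by rewrite /block relabel_K4e !permE !inordK.
have eqD : [set relabel_block pi B | B in cyclic_design k] = D.
  apply/eqP; rewrite eqEcard sub (card_imset _ (can_inj (relabelK pi))).
  by rewrite (card_design designD) (card_design cyclic_designK).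
exists (pi^-1)%g; rewrite -[in LHS]eqD -imset_comp -[RHS]imset_id.
by apply: eq_imset => B; apply: relabelK.
Qed.

Lemma cyclic_hub_rel x y : hub_rel (cyclic_design k) x y -> adj k x y.
Proof.
case/hub_relP=> _ /cyclic_designP[q qk ->] hq; apply/hasP; exists q => //.
have wfq := cyclic_wf qk; have := wf_map (@inord_inj 10) wfq; move: hq.
case: q wfq {qk} => [[[a b] c] d] /and3P[_ al /and4P[bl cl dl _]] /= hq u.
move: hq; rewrite hub_K4e // => /eqP; rewrite eq_sym set2_eq.
by case/orP=> /andP[/eqP-> /eqP->]; rewrite !inordK // eqxx ?orbT.
Qed.

End CyclicDesign.

Lemma cyclic5_linked : tips_linked (cyclic_design 5).
Proof.
have fD i : i < 11 -> block inord (cyclic_quad 5 i) \in cyclic_design 5.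
  by move=> il; apply/cyclic_designP; exists (cyclic_quad 5 i); rewrite // map_f // mem_iota.
have u5 i : i < 11 -> uniq [:: inord i; inord ((i + 1) %% 11); inord ((i + 3) %% 11); inord ((i + 5) %% 11) : 'I_11].
  move=> il; have := wf_map (@inord_inj 10) (@cyclic_wf 5 isT (cyclic_quad 5 i) _); apply.
  by rewrite map_f // mem_iota.
have h i : i < 11 -> hub_rel (cyclic_design 5) (inord i) (inord ((i + 1) %% 11)).
  move=> il; apply/hub_relP; exists (block inord (cyclic_quad 5 i)); first exact: fD.
  by rewrite /= hub_K4e // u5.
(* The base block [0,1,3-5] has tips 3 and 5, both adjacent to 4 through the hub edges of the
   translates by 3 and 4. *)
exists (block inord (cyclic_quad 5 0)), (inord 3), (inord 5), (inord 4); split.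
- exact: fD.
- by rewrite /= tips_K4e // (u5 0).
- exact: (h 3).
- exact: (h 4).
Qed.

Lemma cyclic7_unlinked : ~ tips_linked (cyclic_design 7).
Proof.
case=> _ [c [d [m [/cyclic_designP[q qk ->] tq /(@cyclic_hub_rel 7 isT) cm /(@cyclic_hub_rel 7 isT) md]]]].
have wfq := @cyclic_wf 7 isT _ qk; have uq := wf_map (@inord_inj 10) wfq.
have /allP/(_ q qk)/allP/(_ (m : nat)) := cyclic_quads7_unlinked.
rewrite mem_iota ltn_ord => /(_ isT).
(* Tips form an unordered pair, so [c] and [d] may match those of [q] in reverse; symmetry of [adj]
   settles that case. *)
have adjC x y : adj 7 x y = adj 7 y x by apply: eq_has => q'; rewrite orbC.
case: q wfq uq tq {qk} => [[[a' b'] c'] d'] /and3P[_ al /and4P[bl cl dl _]] u.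
rewrite /= tips_K4e // => /eqP; rewrite set2_eq.
case/orP=> /andP[/eqP cE /eqP dE]; move: cm md; rewrite -cE -dE !inordK // => cm md.
  by rewrite cm md.
by rewrite adjC md adjC cm.
Qed.

Theorem theorem3p3 :
  exists D1 D2 : {set {set {set 'I_11}}},
    [/\ K4e_design D1, K4e_design D2, ~ iso_designs D1 D2 &
        forall D : {set {set {set 'I_11}}}, K4e_design D ->
          iso_designs D D1 \/ iso_designs D D2].
Proof.
exists (cyclic_design 5), (cyclic_design 7); split; try exact: cyclic_designK.
  move=> iso; apply: cyclic7_unlinked.
  exact: tips_linked_iso (@cyclic_designK 5 isT) iso cyclic5_linked.
move=> D designD; have [k [f [k57 finj fD]]] := design_cyclic designD.
have := iso_cyclic k57 designD finj fD.
by move: k57; rewrite !inE => /orP[] /eqP->; [left | right].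
Qed.
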